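(* Let $\chi:\mathbb{R}\to\mathbb{R}$ be a kernel satisfying conditions $(\chi1)$–$(\chi5)$ (listed in the context). Let $a,b\in\mathbb{R}$ with $a<b$, and let $f\in C_{+}(\mathbb{R})$. Suppose that there exists a constant $M>0$, independent of $w>0$ but depending on $f$, $a$ and $b$, such that $$\sup_{x\in[a,b]}|S_{w}^{\chi}(f)(x)-f(x)|\le\frac{M}{w}$$ for all sufficiently large $w>0$. Then: (i) if $0<a<b$, then, for every $c\in[a,b)$, $f$ is a Lipschitz function on $[a,c]$ with Lipschitz constant $Mb\left(\frac{1}{2a}+\frac{1}{b-c}\right)$; (ii) if $a<b<0$, then, for every $c\in(a,b]$, $f$ is a Lipschitz function on $[c,b]$ with Lipschitz constant $Ma\left(\frac{1}{2b}-\frac{1}{c-a}\right)$.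
   Context: $C_{+}(\mathbb{R})$ is the set of all non-negative, bounded, uniformly continuous functions $f:\mathbb{R}\to\mathbb{R}$. The symbol $\bigvee_{k\in J}A_k$ denotes $\sup\{A_k: k\in J\}$. ''$f$ is Lipschitz on an interval $J$ with Lipschitz constant $L$'' means $|f(x)-f(y)|\le L|x-y|$ for all $x,y\in J$. Kernel conditions: $\chi:\mathbb{R}\to\mathbb{R}$ is bounded and measurable, and $(\chi1)$ for some $\beta>0$, $\sup_{y\in\mathbb{R}}|\chi(y)|\,|y|^{\beta}<+\infty$; $(\chi2)$ $\inf_{x\in[-1/2,1/2]}\chi(x)=:a_\chi>0$; $(\chi3)$ $\chi$ is continuous on $\mathbb{R}$, $\chi(x)\ge 0$ for every $x\in\mathbb{R}$, and $\lim_{|x|\to+\infty}\chi(x)=0$; $(\chi4)$ $\chi$ is even; $(\chi5)$ $\chi(x)$ is non-decreasing for $x<0$ and non-increasing for $x\ge 0$. For bounded $f:\mathbb{R}\to\mathbb{R}$ and real $w>0$, the max-product generalized sampling operator is $$S_{w}^{\chi}(f)(x)=\frac{\bigvee_{k\in\mathbb{Z}}f\left(\frac{k}{w}\right)\chi(wx-k)}{\bigvee_{k\in\mathbb{Z}}\chi(wx-k)},\quad x\in\mathbb{R}.$$ *)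

(* Defs.v *)
From HB Require Import structures.
From mathcomp Require Import all_boot all_order all_algebra.
From mathcomp Require Import all_classical all_reals all_analysis.

Set Implicit Arguments.
Unset Strict Implicit.
Unset Printing Implicit Defensive.

Import Order.TTheory GRing.Theory Num.Theory.
Import numFieldNormedType.Exports.

Local Open Scope classical_set_scope.
Local Open Scope ring_scope.

Definition C_plus (R : realType) : set (R -> R) :=
  [set f : R -> R | [/\ forall x, 0 <= f x, bounded_fun f & unif_continuous f]].

(* The supremum in [chi1] is taken in the extended reals, as the real-valued
   [sup] of an unbounded set is 0; the real-valued [inf] in [chi2] is a true
   infimum because [chi] is bounded. *)
Record max_product_kernel (R : realType) (chi : R -> R) : Prop := {
  chi_bounded : bounded_fun chi ;
  chi_measurable : measurable_fun setT chi ;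
  chi1 : exists2 beta : R, 0 < beta &
    (ereal_sup (range (fun y => (`|chi y| * `|y| `^ beta)%:E)) < +oo)%E ;
  chi2 : 0 < inf (chi @` `[- 2^-1, 2^-1]) ;
  chi3_continuous : continuous chi ;
  chi3_ge0 : forall x, 0 <= chi x ;
  chi3_lim_pinfty : chi x @[x --> +oo] --> 0 ;
  chi3_lim_ninfty : chi x @[x --> -oo] --> 0 ;
  chi4 : forall x, chi (- x) = chi x ;
  chi5_nondecreasing : {in `]-oo, 0[ &, nondecreasing_fun chi} ;
  chi5_nonincreasing : {in `[0, +oo[ &, nonincreasing_fun chi} }.

(* Both suprema are true suprema when [f] and [chi] are bounded. *)
Definition max_product_sampling (R : realType) (chi : R -> R) (w : R)
    (f : R -> R) (x : R) : R :=
  sup (range (fun k : int => f (k%:~R / w) * chi (w * x - k%:~R))) /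
  sup (range (fun k : int => chi (w * x - k%:~R))).

(* Main.v *)
Require Import Defs.
From mathcomp Require Import all_boot all_order all_algebra.
From mathcomp Require Import all_classical all_reals all_analysis.
From mathcomp Require Import ring lra.

Set Implicit Arguments.
Unset Strict Implicit.
Unset Printing Implicit Defensive.

Import Order.TTheory GRing.Theory Num.Theory.
Import numFieldNormedType.Exports.

Local Open Scope classical_set_scope.
Local Open Scope ring_scope.

(** At a point [x] the operator cannot fall below the value of [f] at the node
[k / w] nearest to [x]: the kernel is even and decreases away from the origin,
so that node carries the whole normalising supremum
([node_le_max_product_sampling]). An error bound [M / w] on [[a, b]] therefore gives
[f z - f x <= M / w] as soon as [z] is a node and [`|x - z| <= 1 / (2 * w)].

For given [x] and [z] the best choice is [w = 1 / (2 * `|x - z|)], which would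
give [f z - f x <= 2 * M * `|x - z|]. The sampling rate must be lowered a little to make
[z] a node, which is possible because [z] stays away from [0]
([exists_rate_with_node]); for close points this turns [2 * M] into any
[K > 2 * M] ([local_increment_bound]). Exchanging [x] and [z] gives both signs
of the increment, and subdividing a long segment makes the bound global on
[[a, b]] ([lipschitz_of_local]).

Hence [f] is Lipschitz on the whole of [[a, b]] with constant [5 / 2 * M],
and elementary algebra shows that the constants of the theorem are never
smaller ([five_halves_le_constant]). The negative case differs only by the
signs of the end points, as the argument uses only a lower bound on [`|z|]. *)

(** * Lower bound of the operator at the nearest node *)

Lemma bounded_fun_le (R : realType) (T : Type) (g : T -> R) :
  bounded_fun g -> exists B, forall x, g x <= B.
Proof.
move=> [B [_ hB]]; exists (B + 1) => x.
by apply: le_trans (ler_norm _) _; apply: hB => //; rewrite ltrDl.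
Qed.

Lemma kernel_le_of_norm_le (R : realType) (chi : R -> R) (u v : R) :
  max_product_kernel chi -> `|u| <= `|v| -> chi v <= chi u.
Proof.
move=> hchi huv.
have chi_norm t : chi t = chi `|t|.
  by case: (ger0P t) => _ //; rewrite (chi4 hchi).
rewrite (chi_norm u) (chi_norm v).
by apply: (chi5_nonincreasing hchi) => //; rewrite in_itv /= normr_ge0.
Qed.

Lemma kernel_gt0 (R : realType) (chi : R -> R) (u : R) :
  max_product_kernel chi -> `|u| <= 2^-1 -> 0 < chi u.
Proof.
move=> hchi hu; apply: lt_le_trans (chi2 hchi) _.
apply: ge_inf; last by exists u => //=; rewrite in_itv /= -ler_norml.
by exists 0 => _ [t _ <-]; exact: chi3_ge0 hchi t.
Qed.

Lemma nearest_int_dist_le (R : realType) (u : R) (j k : int) :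
  `|u - k%:~R| <= 2^-1 -> `|u - k%:~R| <= `|u - j%:~R|.
Proof.
move=> hu; have [->//|jk] := eqVneq j k.
have h1 : (1 : R) <= `|j%:~R - k%:~R|.
  by rewrite -rmorphB /= -intr_norm ler1z -gtz0_ge1 normr_gt0 subr_eq0.
have := ler_distD u j%:~R (k%:~R : R).
rewrite (distrC j%:~R u); lra.
Qed.

(** With an even kernel that decreases away from the origin, the normalising
supremum is attained at a node nearest to [w * x]; the weight of that node
is then exactly 1, and the numerator is at least its term there. *)
Lemma node_le_max_product_sampling (R : realType) (chi f : R -> R)
    (w x : R) (k : int) :
  max_product_kernel chi -> C_plus f -> `|w * x - k%:~R| <= 2^-1 ->
  f (k%:~R / w) <= max_product_sampling chi w f x.
Proof.
move=> hchi [f0 /bounded_fun_le [B fB] _] hk.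
have [C chiC] := bounded_fun_le (chi_bounded hchi).
have chik := kernel_gt0 hchi hk.
rewrite /max_product_sampling.
have -> : sup (range (fun j : int => chi (w * x - j%:~R))) =
          chi (w * x - k%:~R).
  apply/eqP; rewrite eq_le; apply/andP; split.
    apply: ge_sup; first by exists (chi (w * x - k%:~R)), k.
    by move=> _ [j _ <-]; exact/(kernel_le_of_norm_le hchi)/nearest_int_dist_le.
  by apply: ub_le_sup; [exists C => _ [j _ <-] | exists k].
rewrite ler_pdivlMr //; apply: ub_le_sup; last by exists k.
exists (B * C) => _ [j _ <-].
by apply: ler_pM => //; exact: chi3_ge0 hchi _.
Qed.

(** * From the approximation rate to local increments *)

(** Among the sampling rates close to a given [t] there is one whose lattice
contains [z]: round [t * `|z|] down to an integer and divide by [`|z|]. *)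
Lemma exists_rate_with_node (R : realType) (z t : R) :
  z != 0 -> `|z|^-1 < t ->
  exists w : R, exists k : int,
    [/\ 0 < w, t - `|z|^-1 < w, w <= t & k%:~R / w = z].
Proof.
move=> z0 ht; have z1 : 0 < `|z| by rewrite normr_gt0.
have kle := floor_le (t * `|z|); have := floorD1_gt (t * `|z|).
set k := Num.floor _ in kle *; rewrite intrD => kgt.
have wgt : t - `|z|^-1 < k%:~R / `|z|.
  by rewrite ltr_pdivlMr // mulrBl mulVf ?gt_eqF //; lra.
have w0 : 0 < k%:~R / `|z| by apply: lt_trans wgt; rewrite subr_gt0.
have k0 : k%:~R != 0 :> R.
  by apply: contraTneq w0 => ->; rewrite mul0r ltxx.
have kK : k%:~R / (k%:~R / `|z|) = `|z|.
  by field; rewrite k0 gt_eqF.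
exists (k%:~R / `|z|).
have wle : k%:~R / `|z| <= t by rewrite ler_pdivrMr.
have [zp|zn] := ltrP 0 z.
- by exists k; split=> //; rewrite kK gtr0_norm.
- by exists (- k); split=> //; rewrite rmorphN mulNr kK ler0_norm ?opprK.
Qed.

(** At a distance [h] the best admissible rate is about [1 / (2 * h)], and it
turns the error bound [M / w] into about [2 * M * h]; moving the rate so that
[z] becomes a node costs a relative error of order [h / m]. *)
Lemma local_increment_bound (R : realType) (chi f : R -> R) (a b m M K : R) :
  max_product_kernel chi -> C_plus f ->
  0 < M -> 2 * M < K -> 0 < m -> (forall x, a <= x <= b -> m <= `|x|) ->
  (\forall w \near +oo,
     (ereal_sup [set `|max_product_sampling chi w f x - f x|%:E
                | x in `[a, b]] <= (M / w)%:E)%E) ->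
  exists2 d : R, 0 < d & forall x z, a <= x <= b -> a <= z <= b ->
    `|x - z| <= d -> f z - f x <= K * `|x - z|.
Proof.
move=> hchi hf M0 MK m0 hm [W [_ hW]].
have P0 : 0 < `|W| + m^-1 + 1.
  by rewrite ltr_wpDl // addr_ge0 // invr_ge0 ltW.
have K0 : 0 < K by lra.
(* [d1] keeps the chosen rate above the threshold [W]; [d2] absorbs the loss
   from lowering the rate by [m^-1] into [K - 2 * M]. *)
pose d1 := (2 * (`|W| + m^-1 + 1))^-1; pose d2 := m * (K - 2 * M) / (2 * K).
exists (Num.min d1 d2).
  by rewrite lt_min invr_gt0 mulr_gt0 //= divr_gt0 // mulr_gt0 // subr_gt0.
move=> x z hx hz; rewrite le_min => /andP[].
set h := `|x - z| => hd1 hd2.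
have [xz|xz] := eqVneq x z; first by rewrite xz subrr mulr_ge0 ?normr_ge0 // ltW.
have h0 : 0 < h by rewrite normr_gt0 subr_eq0.
have hmz : `|z|^-1 <= m^-1.
  by rewrite lef_pV2 ?posrE ?hm // (lt_le_trans m0) // hm.
pose t := (2 * h)^-1.
have ht : `|W| + m^-1 + 1 <= t.
  rewrite -[leLHS]invrK lef_pV2 ?posrE ?invr_gt0 ?mulr_gt0 //.
  by move: hd1; rewrite /d1 invfM; lra.
have W0 : W <= `|W| := ler_norm W.
have W00 : 0 <= `|W| := normr_ge0 W.
have [||w [k [w0 wgt wle wk]]] := @exists_rate_with_node _ z t.
- by rewrite -normr_gt0 (lt_le_trans m0) // hm.
- lra.
have kE : k%:~R = w * z by rewrite -wk mulrC divfK // gt_eqF.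
have near : `|w * x - k%:~R| <= 2^-1.
  rewrite kE -mulrBr normrM (gtr0_norm w0) -/h.
  apply: le_trans (ler_wpM2r (ltW h0) wle) _.
  by rewrite /t invfM mulfVK // gt_eqF.
have := node_le_max_product_sampling hchi hf near; rewrite wk => fzS.
have hSx : `|max_product_sampling chi w f x - f x| <= M / w.
  rewrite -lee_fin; apply: le_trans (hW w _); last by lra.
  by apply: ereal_sup_ubound; exists x => //=; rewrite in_itv.
have := le_trans (ler_norm _) hSx => fSx.
suff : M / w <= K * h by lra.
rewrite ler_pdivrMr //.
have hKt : K * h * (t - m^-1) <= K * h * w.
  by apply: ler_wpM2l; [rewrite mulr_ge0 ?ltW | lra].
apply: le_trans hKt.
have -> : K * h * (t - m^-1) = K / 2 - K * h / m.
  by rewrite /t; field; rewrite !gt_eqF.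
move: hd2; rewrite /d2 ler_pdivlMr ?mulr_gt0 // => hd2.
have : K * h / m <= (K - 2 * M) / 2 by rewrite ler_pdivrMr //; lra.
lra.
Qed.

(** * Gluing local increments *)

(** Induction on the number [n] of pieces: the first piece is cut off at the
proportion [1 / n] of the segment, so that the remaining part still meets the
length bound for [n - 1] pieces and increments add up exactly. *)
Lemma lipschitz_of_local (R : realFieldType) (f : R -> R) (a b d K : R) (n : nat)
    (x y : R) :
  0 <= d ->
  (forall x z, a <= x <= b -> a <= z <= b -> `|x - z| <= d ->
     `|f x - f z| <= K * `|x - z|) ->
  a <= x <= b -> a <= y <= b -> `|x - y| <= n%:R * d ->
  `|f x - f y| <= K * `|x - y|.
Proof.
move=> d0 hloc; elim: n x => [|n IHn] x hx hy hxy.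
  by apply: hloc => //; lra.
pose s : R := n.+1%:R^-1; pose z := x + s * (y - x).
have s0 : 0 < s by rewrite invr_gt0 ltr0Sn.
have s1 : s <= 1 by rewrite invf_le1 ?ltr0Sn // ler1n.
have ns : n.+1%:R * s = 1 by rewrite mulfV // pnatr_eq0.
have hz : a <= z <= b by rewrite /z; nra.
have xz : `|x - z| = s * `|x - y|.
  by rewrite -{1}(gtr0_norm s0) -normrM; congr `|_|; rewrite /z; ring.
have zy : `|z - y| = (1 - s) * `|x - y|.
  have s10 : 0 <= 1 - s by lra.
  by rewrite -{1}(ger0_norm s10) -normrM; congr `|_|; rewrite /z; ring.
have hxz : `|x - z| <= d.
  by rewrite xz /s mulrC ler_pdivrMr ?ltr0Sn // mulrC.
have hzy : `|z - y| <= n%:R * d.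
  have -> : n%:R * d = (1 - s) * (n.+1%:R * d).
    by rewrite mulrA mulrBl mul1r (mulrC s) ns -natr1 addrK.
  by rewrite zy; apply: ler_wpM2l => //; lra.
have := hloc _ _ hx hz hxz; have := IHn _ hz hy hzy.
have := ler_distD (f z) (f x) (f y); rewrite xz zy; lra.
Qed.

Lemma lipschitz_of_rate (R : realType) (chi f : R -> R) (a b m M K : R) :
  max_product_kernel chi -> C_plus f ->
  0 < M -> 2 * M < K -> 0 < m -> (forall x, a <= x <= b -> m <= `|x|) ->
  (\forall w \near +oo,
     (ereal_sup [set `|max_product_sampling chi w f x - f x|%:E
                | x in `[a, b]] <= (M / w)%:E)%E) ->
  forall x y, a <= x <= b -> a <= y <= b -> `|f x - f y| <= K * `|x - y|.
Proof.
move=> hchi hf M0 MK m0 hm hrate x y hx hy.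
have [d d0 hd] := local_increment_bound hchi hf M0 MK m0 hm hrate.
apply: (@lipschitz_of_local _ f a b d K (Num.bound (`|x - y| / d))) => //.
- exact: ltW.
- move=> u v hu hv uv; rewrite ler_norml; apply/andP; split.
    by have := hd _ _ hu hv uv; lra.
  by have := hd v u hv hu; rewrite (distrC v u); apply.
- rewrite -ler_pdivrMr //; apply: ltW.
  by apply: archi_boundP; rewrite divr_ge0 // ltW.
Qed.

(** * Comparison of the constants *)

(** The right side grows with [q], and at [q = p + e] the claim, cleared of
denominators, is [0 <= (e - p) ^+ 2 + p ^+ 2]. *)
Lemma five_halves_le_constant (R : realFieldType) (p q e : R) :
  0 < p -> 0 < e -> e <= q - p ->
  5 / 2 <= q * (1 / (2 * p) + 1 / e).
Proof.
move=> p0 e0 eqp.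
have -> : q * (1 / (2 * p) + 1 / e) = q * (e + 2 * p) / (2 * p * e).
  by field; rewrite !gt_eqF.
rewrite ler_pdivlMr ?mulr_gt0 //.
have : (p + e) * (e + 2 * p) <= q * (e + 2 * p) by apply: ler_wpM2r; lra.
have := sqr_ge0 (e - p); have := sqr_ge0 p; lra.
Qed.

Theorem theorem4p1 (R : realType) (chi : R -> R)
    (hchi : max_product_kernel chi)
    (a b : R) (hab : a < b)
    (f : R -> R) (hf : C_plus f)
    (M : R) (hM : 0 < M)
    (hrate : \forall w \near +oo,
       (ereal_sup [set `|max_product_sampling chi w f x - f x|%:E
                  | x in `[a, b]] <= (M / w)%:E)%E) :
  (0 < a ->
    forall c : R, c \in `[a, b[ ->
      (M * b * (1 / (2 * a) + 1 / (b - c))).-lipschitz_(`[a, c]) f) /\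
  (b < 0 ->
    forall c : R, c \in `]a, b] ->
      (M * a * (1 / (2 * b) - 1 / (c - a))).-lipschitz_(`[c, b]) f).
Proof.
have MK : 2 * M < M * (5 / 2) by lra.
split=> [a0|b0] c; rewrite in_itv /= => /andP[ac cb] [x y] /= [];
  rewrite !in_itv /= => /andP[x1 x2] /andP[y1 y2].
  (* The end point nearest to [0] bounds [`|u|] from below. *)
- have ha u : a <= u <= b -> a <= `|u|.
    by move=> /andP[au _]; apply: le_trans au (ler_norm u).
  have hx : a <= x <= b by lra.
  have hy : a <= y <= b by lra.
  apply: le_trans (lipschitz_of_rate hchi hf hM MK a0 ha hrate hx hy) _.
  apply: ler_wpM2r => //; rewrite -mulrA; apply: ler_wpM2l; first exact: ltW.
  by apply: five_halves_le_constant; lra.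
- have b0' : 0 < - b by lra.
  have hb u : a <= u <= b -> - b <= `|u|.
    by move=> /andP[_ ub]; rewrite -normrN; apply: le_trans (ler_norm _); lra.
  have hx : a <= x <= b by lra.
  have hy : a <= y <= b by lra.
  apply: le_trans (lipschitz_of_rate hchi hf hM MK b0' hb hrate hx hy) _.
  apply: ler_wpM2r => //; rewrite -mulrA; apply: ler_wpM2l; first exact: ltW.
  have -> : a * (1 / (2 * b) - 1 / (c - a)) =
            - a * (1 / (2 * - b) + 1 / (c - a)).
    by field; rewrite (lt_eqF b0) gt_eqF // subr_gt0.
  by apply: five_halves_le_constant; lra.
Qed.
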